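(* Let $K$ be any field. Up to isomorphism there are exactly two nilpotent Jordan algebras of dimension $2$ over $K$, namely the following, each with basis $a,b$: With central component: $J_{2,1}$, in which all products are zero. Without central component: $J_{2,2}$, with $a^2=b$.
   Context: A Jordan algebra over a field $K$ is a $K$-vector space $J$ with a symmetric bilinear product $\circ:J\times J\to J$ satisfying $x^2\circ(x\circ y)=x\circ(x^2\circ y)$ for all $x,y\in J$, where $x^2=x\circ x$. Set $c^1(J)=J$ and $c^m(J)=c^{m-1}(J)\circ J$ (the span of the products) for $m\geq 2$; $J$ is nilpotent if $c^n(J)=0$ for some $n$. The centre is $Z(J)=\{x\in J: x\circ y=0\ \forall y\in J\}$. $J$ has a central component if $J=I_1\oplus I_2$ is a direct sum of two ideals with $I_2$ nonzero and contained in $Z(J)$. In the multiplication tables, products of basis vectors that are not listed (and do not follow from commutativity) are zero. *)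

(* Defs.v *)
From HB Require Import structures.
From mathcomp Require Import all_boot all_order all_algebra.

Set Implicit Arguments.
Unset Strict Implicit.
Unset Printing Implicit Defensive.

Import GRing.Theory.
Local Open Scope ring_scope.

Reserved Notation "x *j y" (at level 40, left associativity).

(* Finite-dimensional Jordan algebras. The field is arbitrary, in particular
   its characteristic may be 2 or 3. *)
HB.mixin Record Vector_isJordan (K : fieldType) J of Vector K J := {
  jmul : J -> J -> J;
  jmul_is_bilinear : bilinear_for *:%R *:%R jmul;
  jmulC : commutative jmul;
  jordan_identity : forall x y,
    jmul (jmul x x) (jmul x y) = jmul x (jmul (jmul x x) y)
}.

#[short(type="jordanType")]
HB.structure Definition Jordan (K : fieldType) :=
  {J of Vector_isJordan K J & Vector K J}.

Notation "x *j y" := (jmul x y) : ring_scope.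

HB.instance Definition _ (K : fieldType) (J : jordanType K) :=
  bilinear_isBilinear.Build K J J J *:%R *:%R (@jmul K J) jmul_is_bilinear.

Section JordanTheory.
Variables (K : fieldType) (J : jordanType K).
Implicit Types (x y : J) (U V W : {vspace J}).

(* The span of all products x *j y with x \in U and y \in V: by bilinearity it
   is enough to multiply basis vectors, see jprodvP. *)
Definition jprodv U V : {vspace J} :=
  <<[seq u *j v | u <- vbasis U, v <- vbasis V]>>%VS.

Lemma memv_jmul U V u v : u \in U -> v \in V -> u *j v \in jprodv U V.
Proof.
move=> Uu Vv; rewrite (coord_vbasis Uu) (coord_vbasis Vv).
rewrite linear_sumlz rpred_sum // => i _; rewrite linearZl_LR rpredZ //.
rewrite linear_sumr rpred_sum // => j _; rewrite linearZr_LR rpredZ //.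
by apply: memv_span; apply: allpairs_f; apply: mem_nth; rewrite size_tuple.
Qed.

Lemma jprodvP U V W :
  reflect {in U & V, forall u v, u *j v \in W} (jprodv U V <= W)%VS.
Proof.
apply: (iffP idP) => [sUVW u v Uu Vv | sUVW].
  by rewrite (subvP sUVW) ?memv_jmul.
apply/span_subvP => _ /allpairsP[[u v] /= [Uu Vv ->]].
by rewrite sUVW ?vbasis_mem.
Qed.

(* Indexed from 1; the value at 0 is a dummy one. *)
Definition jlcs (m : nat) : {vspace J} :=
  iter m.-1 (fun U => jprodv U fullv) fullv.

Definition jnilpotent : Prop :=
  exists n : nat, (0 < n)%N /\ jlcs n = 0%VS.

Definition in_jcentre x : Prop := forall y, x *j y = 0.

(* One-sided, the product being commutative. *)
Definition jideal U : Prop := forall x y, x \in U -> x *j y \in U.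

Definition has_central_component : Prop :=
  exists I1 I2 : {vspace J},
    [/\ jideal I1, jideal I2, (I1 + I2)%VS = fullv & directv (I1 + I2)] /\
    (I2 != 0%VS /\ forall x, x \in I2 -> in_jcentre x).

End JordanTheory.

Arguments jnilpotent {K} J.
Arguments has_central_component {K} J.

Definition jisomorphic (K : fieldType) (J J' : jordanType K) : Prop :=
  exists f : {linear J -> J'},
    bijective f /\ {morph f : x y / x *j y >-> x *j y}.

Section Tables.
Variables (K : fieldType) (n : nat) (T : 'I_n -> 'I_n -> 'rV[K]_n).

(* The bilinear product on 'rV_n whose value at the i-th and j-th vectors of
   the standard basis is T i j. *)
Definition table_mul (u v : 'rV[K]_n) : 'rV[K]_n :=
  \sum_(i < n) \sum_(j < n) (u 0 i * v 0 j) *: T i j.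

Lemma table_mul_is_bilinear : bilinear_for *:%R *:%R table_mul.
Proof.
split=> [v c x y | u c x y]; rewrite /= /table_mul scaler_sumr -big_split /=;
  apply: eq_bigr => i _; rewrite scaler_sumr -big_split /=;
  apply: eq_bigr => j _; rewrite !mxE scalerA -scalerDl.
  by rewrite mulrDl mulrA.
by rewrite mulrDr mulrCA.
Qed.

Lemma table_mulC :
  (forall i j, T i j = T j i) -> commutative table_mul.
Proof.
move=> TC u v; rewrite /table_mul exchange_big /=.
by apply: eq_bigr => i _; apply: eq_bigr => j _; rewrite mulrC TC.
Qed.

Lemma table_mul_basis i j :
  table_mul (delta_mx 0 i) (delta_mx 0 j) = T i j.
Proof.
rewrite /table_mul (bigD1 i) //= [X in _ + X]big1 ?addr0; last first.
  move=> k /negPf ki; rewrite big1 // => l _.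
  by rewrite mxE ki andbF mul0r scale0r.
rewrite (bigD1 j) //= big1 ?addr0; last first.
  by move=> l /negPf lj; rewrite [X in _ * X]mxE lj andbF mulr0 scale0r.
by rewrite !mxE !eqxx mulr1 scale1r.
Qed.

End Tables.

Section TwoDimensional.
Variable K : fieldType.

Local Notation a := (delta_mx 0 0 : 'rV[K]_2).
Local Notation b := (delta_mx 0 1 : 'rV[K]_2).

Definition table21 (i j : 'I_2) : 'rV[K]_2 := 0.

Definition table22 (i j : 'I_2) : 'rV[K]_2 :=
  if (i == 0) && (j == 0) then b else 0.

Definition J21 : Type := 'rV[K]_2.
Definition J22 : Type := 'rV[K]_2.

HB.instance Definition _ := Vector.copy J21 'rV[K]_2.
HB.instance Definition _ := Vector.copy J22 'rV[K]_2.

Fact J21_mulE u v : table_mul table21 u v = 0.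
Proof.
by rewrite /table_mul big1 // => i _; rewrite big1 // => j _; rewrite scaler0.
Qed.

Fact J22_mulE u v : table_mul table22 u v = (u 0 0 * v 0 0) *: b.
Proof.
rewrite /table_mul (bigD1 0) //= (bigD1 0) //= /table22 eqxx /=.
rewrite big1 ?addr0 => [|j /negPf ->]; last by rewrite scaler0.
rewrite big1 ?addr0 // => i /negPf ->.
by rewrite big1 // => j _; rewrite scaler0.
Qed.

Fact J21_mulC : commutative (table_mul table21).
Proof. by apply: table_mulC. Qed.

Fact J22_mulC : commutative (table_mul table22).
Proof. by apply: table_mulC => i j; rewrite /table22 andbC. Qed.

Fact J21_jordan (x y : 'rV[K]_2) (m := table_mul table21) :
  m (m x x) (m x y) = m x (m (m x x) y).
Proof. by rewrite /m !J21_mulE. Qed.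

Fact J22_jordan (x y : 'rV[K]_2) (m := table_mul table22) :
  m (m x x) (m x y) = m x (m (m x x) y).
Proof. by rewrite /m !J22_mulE !mxE /= !(mulr0, mul0r). Qed.

HB.instance Definition _ := Vector_isJordan.Build K J21
  (table_mul_is_bilinear table21) J21_mulC J21_jordan.
HB.instance Definition _ := Vector_isJordan.Build K J22
  (table_mul_is_bilinear table22) J22_mulC J22_jordan.

Lemma J21_mul0 (x y : J21) : x *j y = 0.
Proof. exact: J21_mulE. Qed.

Lemma J22_table (a' := a : J22) (b' := b : J22) :
  [/\ a' *j a' = b', a' *j b' = 0, b' *j a' = 0 & b' *j b' = 0].
Proof. by split; exact: table_mul_basis. Qed.

End TwoDimensional.

(* Main.v *)
(** If [J] is nilpotent and [U <= U J] then [U = 0].  For [\dim J = 2] and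
    [J^2 <> 0] this applied to [J] and to [J^2] makes [J^2] a line with
    [J^2 J = 0].  For [x] outside [J^2] the square [x^2] is then nonzero, because
    it spans [J^2], so [x, x^2] is a basis with the table of [J22].  Squares
    are never polarised, so characteristic 2 plays no special role. *)
From HB Require Import structures.
Require Import Defs.
From mathcomp Require Import all_boot all_order all_algebra.

Set Implicit Arguments.
Unset Strict Implicit.
Unset Printing Implicit Defensive.

Import GRing.Theory.
Local Open Scope ring_scope.

Section Nilpotency.
Variables (K : fieldType) (J : jordanType K).
Implicit Types (x y : J) (U V W : {vspace J}).

Lemma jprodvS U1 U2 V1 V2 :
  (U1 <= U2)%VS -> (V1 <= V2)%VS -> (jprodv U1 V1 <= jprodv U2 V2)%VS.
Proof.
move=> /subvP sU /subvP sV; apply/jprodvP => u v Uu Vv.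
by rewrite memv_jmul ?sU ?sV.
Qed.

(** Monotonicity of [jprodv] puts [U] inside every term of the lower central series, hence inside a
    zero one. *)
Lemma jnilpotent_subv_jprodv U :
  jnilpotent J -> (U <= jprodv U fullv)%VS -> U = 0%VS.
Proof.
case=> n [_ Jn0] sU; apply/eqP; rewrite -subv0 -Jn0 /jlcs.
elim: n.-1 => [|m IHm] /=; first exact: subvf.
exact: subv_trans sU (jprodvS IHm (subvv _)).
Qed.

(** A subspace of a line is zero or the whole line, and nilpotency rules out the second case. *)
Lemma jprodv_line_eq0 U :
  jnilpotent J -> \dim U = 1%N -> (jprodv U fullv <= U)%VS ->
  jprodv U fullv = 0%VS.
Proof.
move=> Jnil dimU sPU; apply/eqP; rewrite -dimv_eq0 -leqn0 -ltnS -dimU.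
rewrite ltn_neqAle dimvS // andbT; apply/eqP => eq_dim.
suff U0 : U = 0%VS by rewrite U0 dimv0 in dimU.
apply: jnilpotent_subv_jprodv => //.
by have := dimv_leqif_sup sPU; case=> _ <-; apply/eqP.
Qed.

End Nilpotency.

Section Coordinates.
Variables (K : fieldType) (n : nat) (J : jordanType K) (X : n.-tuple J).
Hypothesis basisX : basis_of fullv X.

(** Its target is the space underlying [J21] and [J22], so it is the candidate isomorphism. *)
Definition coord_row (v : J) : 'rV[K]_n := \row_i coord X i v.

Fact coord_row_is_linear : linear coord_row.
Proof. by move=> c u v; apply/rowP => i; rewrite !mxE linearP. Qed.

HB.instance Definition _ :=
  GRing.isLinear.Build K J 'rV[K]_n _ coord_row coord_row_is_linear.

Lemma sum_coord_row v : v = \sum_i coord_row v 0 i *: X`_i.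
Proof.
rewrite {1}(coord_basis basisX (memvf v)).
by apply: eq_bigr => i _; rewrite mxE.
Qed.

Lemma coord_row_sum (u : 'rV[K]_n) : coord_row (\sum_i u 0 i *: X`_i) = u.
Proof.
by apply/rowP => i; rewrite mxE coord_sum_free ?(basis_free basisX).
Qed.

Lemma coord_row_bij : bijective coord_row.
Proof.
exists (fun u : 'rV[K]_n => \sum_i u 0 i *: X`_i) => [v|u].
  by rewrite -sum_coord_row.
exact: coord_row_sum.
Qed.

(** Both products are bilinear, so agreement on a basis suffices. *)
Lemma coord_row_table (T : 'I_n -> 'I_n -> 'rV[K]_n) :
  (forall i j : 'I_n, coord_row (X`_i *j X`_j) = T i j) ->
  {morph coord_row : u v / u *j v >-> table_mul T u v}.
Proof.
move=> XT u v; rewrite {1}(sum_coord_row u) {1}(sum_coord_row v).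
rewrite linear_sumlz linear_sum.
apply: eq_bigr => i _; rewrite linear_sumr linear_sum.
apply: eq_bigr => j _; rewrite linearZr_LR linearZl_LR !linearZ /= XT.
by rewrite scalerA mulrC.
Qed.

End Coordinates.

Section Classification.
Variables (K : fieldType) (J : jordanType K).
Hypothesis dimJ : \dim {: J} = 2%N.

Lemma jisomorphic_J21 : (forall x y : J, x *j y = 0) -> jisomorphic J (J21 K).
Proof.
move=> J0; have [X basisX] : {X : 2.-tuple J | basis_of fullv X}.
  by rewrite -dimJ; exists (vbasis fullv); apply: vbasisP.
exists (coord_row X : {linear J -> 'rV[K]_2}).
split; first exact: coord_row_bij.
move=> u v /=; rewrite J21_mul0 J0.
by apply/rowP => i; rewrite !mxE linear0.
Qed.

(** In the basis [x], [x *j x] every product other than the square of [x] has the annihilating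
    factor [x *j x]. *)
Lemma jisomorphic_J22 (x : J) :
  free [:: x; x *j x] -> (forall y, (x *j x) *j y = 0) ->
  jisomorphic J (J22 K).
Proof.
move=> freeX xx0; pose X := [tuple x; x *j x].
have basisX : basis_of fullv X by rewrite basisEfree freeX subvf dimJ.
exists (coord_row X : {linear J -> 'rV[K]_2}).
split; first exact: coord_row_bij.
apply: (coord_row_table basisX) => i j; rewrite /table22.
have X1 (k : 'I_2) : k != 0 -> X`_k = x *j x :> J.
  by case: k => [[|[|k]] //= ltk].
have [-> | ni0] := eqVneq i 0; last first.
  by rewrite X1 // xx0; apply/rowP => k; rewrite !mxE linear0.
have [-> | nj0] := eqVneq j 0; last first.
  by rewrite (X1 j) // jmulC xx0; apply/rowP => k; rewrite !mxE linear0.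
(* Reading [x *j x] as the second basis vector turns its coordinates into Kronecker deltas, the
   entries of [b]. *)
apply/rowP => k; rewrite !mxE /= -[x *j x]/(X`_(1%R : 'I_2)).
by rewrite (coord_free _ _ freeX) eq_sym.
Qed.

Lemma jnilpotent_dim2 :
  jnilpotent J -> jisomorphic J (J21 K) \/ jisomorphic J (J22 K).
Proof.
move=> Jnil; pose D := jprodv {: J} {: J}.
have [D0 | nzD] := eqVneq D 0%VS.
  left; apply: jisomorphic_J21 => x y; apply/eqP.
  by rewrite -memv0 -D0 memv_jmul ?memvf.
right; have nDf : ~~ ({: J} <= D)%VS.
  apply/negP => /(jnilpotent_subv_jprodv Jnil) J0.
  by move: dimJ; rewrite J0 dimv0.
(* [D] is nonzero and proper in a plane. *)
have dimD : \dim D = 1%N.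
  apply/eqP; rewrite eqn_leq lt0n dimv_eq0 nzD andbT -ltnS -dimJ.
  rewrite ltn_neqAle dimvS ?subvf // andbT.
  by have [_ ->] := dimv_leqif_sup (subvf D).
have DJ0 : jprodv D fullv = 0%VS.
  by apply: jprodv_line_eq0 => //; apply: jprodvS; rewrite ?subvf.
have Dcentral d y : d \in D -> d *j y = 0.
  by move=> Dd; apply/eqP; rewrite -memv0 -DJ0 memv_jmul ?memvf.
have [x _ Dx] := subvPn nDf.
(* The line through [x] meets [D] only in zero, so the dimensions add up to 2. *)
have xD : (<[x]> + D = fullv)%VS.
  apply/eqP; rewrite eqEdim subvf dimJ /= dimv_disjoint_sum ?dim_vline.
    by rewrite dimD; case: eqP Dx => // ->; rewrite mem0v.
  apply/eqP; rewrite -subv0; apply/subvP => v; rewrite memv_cap memv0.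
  case/andP=> /vlineP[c ->]; have [-> | nzc] := eqVneq c 0.
    by rewrite scale0r.
  by rewrite rpredZeq (negPf nzc) (negPf Dx).
(* With [D] annihilating, (kx + d)(lx + e) = kl x^2, so x^2 = 0 would force [D] to vanish. *)
have nzxx : x *j x != 0.
  apply: contra nzD => /eqP xx0; rewrite -subv0; apply/jprodvP => u v.
  rewrite -xD => /memv_addP[_ /vlineP[k ->] [d Dd ->]].
  case/memv_addP=> _ /vlineP[l ->] [e De ->].
  rewrite linearDl linearDr /= (Dcentral d) // (jmulC _ e).
  by rewrite (Dcentral e) // linearZl_LR linearZr_LR /= xx0 !scaler0 !addr0 mem0v.
have Dxx : x *j x \in D by rewrite memv_jmul ?memvf.
apply: (@jisomorphic_J22 x) => [|y]; last exact: Dcentral.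
rewrite free_cons seq1_free nzxx andbT span_seq1.
by apply: contra Dx => /vlineP[c ->]; rewrite memvZ.
Qed.

End Classification.

Section Tables.
Variable K : fieldType.
Local Notation a := (delta_mx 0 0 : J22 K).
Local Notation b := (delta_mx 0 1 : J22 K).

Lemma J22_mul (x y : J22 K) : x *j y = (x 0 0 * y 0 0) *: b.
Proof. exact: J22_mulE. Qed.

Lemma J22_b_neq0 : b != 0.
Proof. by apply/eqP => /rowP/(_ 1)/eqP; rewrite !mxE !eqxx oner_eq0. Qed.

Lemma dim_J21 : \dim {: J21 K} = 2%N.
Proof. by rewrite dimvf. Qed.

Lemma dim_J22 : \dim {: J22 K} = 2%N.
Proof. by rewrite dimvf. Qed.

Lemma jnilpotent_J21 : jnilpotent (J21 K).
Proof.
exists 2%N; split=> //; apply/eqP; rewrite -subv0; apply/jprodvP => u v _ _.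
by rewrite J21_mul0 mem0v.
Qed.

Lemma has_central_component_J21 : has_central_component (J21 K).
Proof.
(* The whole algebra is central, and the complementary ideal may be zero. *)
exists 0%VS, fullv; split; last first.
  by split=> [|x _ y]; rewrite ?J21_mul0 // -dimv_eq0 dim_J21.
split=> [x y _|x y _||]; rewrite ?J21_mul0 ?mem0v ?add0v //.
by apply/directv_addP; rewrite cap0v.
Qed.

Lemma jnilpotent_J22 : jnilpotent (J22 K).
Proof.
(* All products are multiples of [b], and [b] annihilates everything since its first coordinate is
   0. *)
exists 3%N; split=> //; apply/eqP; rewrite -subv0; apply/jprodvP => u v.
have sb : (jprodv {: J22 K} {: J22 K} <= <[b]>)%VS.
  by apply/jprodvP => x y _ _; rewrite J22_mul memvZ ?memv_line.
move=> /(subvP sb)/vlineP[c ->] _; rewrite J22_mul !mxE /=.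
by rewrite mulr0 mul0r scale0r mem0v.
Qed.

(** Multiplying by [a] reads off the first coordinate of [x], which must therefore vanish. *)
Lemma J22_centre_line (x : J22 K) : in_jcentre x -> x = x 0 1 *: b.
Proof.
move=> /(_ a)/eqP; rewrite J22_mul scaler_eq0 (negPf J22_b_neq0) orbF.
rewrite mxE !eqxx mulr1 => /eqP x00; apply/rowP => i; rewrite !mxE /=.
by case: i => [[|[|i]] //= lti]; rewrite ?mulr0 ?mulr1 -?x00;
  congr (x _ _); apply: val_inj.
Qed.

(** Both summands would contain [b]: [I2] as a nonzero subspace of the central line, [I1] as an
    ideal through which [b] arises as a square. *)
Lemma no_central_component_J22 : ~ has_central_component (J22 K).
Proof.
case=> I1 [I2 [[I1id _ I12f /directv_addP I12_0] [nzI2 I2Z]]].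
have I2b : b \in I2.
  have /J22_centre_line def_v := I2Z _ (memv_pick I2).
  have := memv_pick I2; rewrite {1}def_v rpredZeq => /predU1P[c0 | //].
  by move: nzI2; rewrite -vpick0 def_v c0 scale0r eqxx.
have I1b : b \in I1.
  have := memvf a; rewrite -I12f => /memv_addP[u I1u [v I2v def_a]].
  (* In [b = a *j a] the left factor is split as [u + v], and the central part [v] contributes
     nothing. *)
  have -> : b = u *j a.
    have [<- _ _ _] := J22_table K.
    by rewrite [X in X *j _]def_a linearDl /= (I2Z v) ?addr0.
  exact: I1id.
have: b \in (I1 :&: I2)%VS by rewrite memv_cap I1b.
by rewrite I12_0 memv0 (negPf J22_b_neq0).
Qed.

(** By surjectivity [a] is an image, so its square [b] would be the image of a zero product. *)
Lemma J21_not_jisomorphic_J22 : ~ jisomorphic (J21 K) (J22 K).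
Proof.
case=> f [[g _ gK] fM]; have [aa _ _ _] := J22_table K.
by move: J22_b_neq0; rewrite -aa -(gK a) -fM J21_mul0 linear0 eqxx.
Qed.

End Tables.

Theorem theorem32 (K : fieldType) :
  [/\ \dim {: J21 K} = 2%N, jnilpotent (J21 K)
    & has_central_component (J21 K)] /\
  [/\ \dim {: J22 K} = 2%N, jnilpotent (J22 K)
    & ~ has_central_component (J22 K)] /\
  ~ jisomorphic (J21 K) (J22 K) /\
  (forall J : jordanType K, \dim {: J} = 2%N -> jnilpotent J ->
    jisomorphic J (J21 K) \/ jisomorphic J (J22 K)).
Proof.
split.
  split; [exact: dim_J21 | exact: jnilpotent_J21 |].
  exact: has_central_component_J21.
split.
  split; [exact: dim_J22 | exact: jnilpotent_J22 |].
  exact: no_central_component_J22.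
split; first exact: J21_not_jisomorphic_J22.
exact: jnilpotent_dim2.
Qed.
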